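(* Let $p\ge 5$ be a prime and put $n:=2^{p-1}$. Define double-indexed sequences $A_r(k)$, $B_r(k)$ (integers $r\ge 0$, $k\ge 0$) by $A_r(0)=B_r(0)=1$ for all $r$ and, for $k\ge 1$, $$A_r(k)=(p-r-k)\,A_r(k-1)+4\,(p-2r)\,A_{r+1}(k-1),$$ $$B_r(k)=-2\,(n-r-k)\,B_r(k-1)-2\,(n-2r-1)\,B_{r+1}(k-1).$$ Then both ratios $$\frac{A_0(\lfloor p/2\rfloor)}{(p-1)(p-2)\cdots(p-\lfloor p/2\rfloor)},\qquad \frac{B_0(\lfloor n/2\rfloor)}{(n-1)(n-2)\cdots(n-\lfloor n/2\rfloor)}$$ are integers. Moreover, $2^p-1$ is prime if and only if $$\frac{A_0(\lfloor p/2\rfloor)}{(p-1)(p-2)\cdots(p-\lfloor p/2\rfloor)}\ \Big|\ \frac{B_0(\lfloor n/2\rfloor)}{(n-1)(n-2)\cdots(n-\lfloor n/2\rfloor)}.$$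
   Context: Here $a\mid b$ denotes divisibility in the integers. *)

(* Defs.v *)
From mathcomp Require Import all_boot all_order all_algebra.

Set Implicit Arguments.
Unset Strict Implicit.
Unset Printing Implicit Defensive.

Import Order.TTheory GRing.Theory Num.Theory.
Local Open Scope ring_scope.

(* [Arec p k r] is A_r(k) and [Brec n k r] is B_r(k): k comes before r.  All the
   subtractions are in [int], so no factor is truncated at 0. *)
Fixpoint Arec (p k r : nat) : int :=
  if k is k'.+1 then
    (p%:Z - r%:Z - k%:Z) * Arec p k' r
    + 4%:Z * (p%:Z - 2%:Z * r%:Z) * Arec p k' r.+1
  else 1.

Fixpoint Brec (n k r : nat) : int :=
  if k is k'.+1 then
    - 2%:Z * (n%:Z - r%:Z - k%:Z) * Brec n k' r
    - 2%:Z * (n%:Z - 2%:Z * r%:Z - 1) * Brec n k' r.+1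
  else 1.

Definition halfprod (m : nat) : int :=
  \prod_(1 <= i < (m./2).+1) (m%:Z - i%:Z).

Definition Aratio (p : nat) : rat := (Arec p p./2 0)%:~R / (halfprod p)%:~R.

Definition Bratio (n : nat) : rat := (Brec n n./2 0)%:~R / (halfprod n)%:~R.

(* Main.v *)
Require Import Defs.
From mathcomp Require Import all_boot all_order all_algebra all_field.
From mathcomp Require Import zify ring.

Set Implicit Arguments.
Unset Strict Implicit.
Unset Printing Implicit Defensive.

Import Order.TTheory GRing.Theory Num.Theory.
Local Open Scope ring_scope.

(** Each recurrence is a weighted count of lattice paths, and the weight of a
    path turns out to depend only on how many steps of each kind it contains
    ([two_param_rec_sum]).  Unrolling it and dividing by the product
    (m-1)(m-2)...(m-m/2) leaves the classical coefficients of the Lucas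
    polynomials,
      m/(m-j) * C(m-j, j) = C(m-j, j) + C(m-j-1, j-1),
    so both ratios are values of V_m(t) = x^m + y^m, where x + y = 1 and
    x * y = - t ([lucas_sum], [bin_half_lucas_coef]).

    For A one gets t = 2, hence {x, y} = {2, -1} and, p being odd, the ratio is
    the Mersenne number 2^p - 1 ([Arec_odd]).  For B one gets t = 1/2 and a
    factor (-2)^(n/2); there x^2 and y^2 are (2 + sqrt 3)/2 and its conjugate,
    so the ratio is, up to the sign (-1)^(n/2), the trace
    (2 + sqrt 3)^(n/2) + (2 - sqrt 3)^(n/2) ([Brec_even]).  With n = 2^(p-1) the
    exponent is 2^(p-2), the sign is +, and this trace is the last term of
    the sequence 4, 14, 194, ... of Lucas and Lehmer.  The divisibility in the
    theorem is therefore the Lucas-Lehmer criterion ([lucas_lehmer]).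

    That criterion is proved in an algebraically closed field of prime
    characteristic q, with a root z of X^2 - 4 X + 1 playing 2 + sqrt 3.  The
    trace of exponent 2^(p-2) vanishes there exactly when z^(2^(p-1)) = -1,
    which makes z of order 2^p.  Frobenius permutes the roots z and 1/z, so the
    order of z divides q - 1 or q + 1: this forces q >= 2^p - 1 for every prime
    factor q of 2^p - 1, i.e. primality.  Conversely, for q = 2^p - 1 prime one
    computes z^((q+1)/2) from 2 z = (z - 1)^2, knowing that 2 is a square and 3
    is not a square modulo q ([lucas_lehmer_Mersenne]). *)

(** * Triangular recurrences as weighted path counts *)

(** Unrolling F k r amounts to summing over paths from (k, r) to level 0, each
    step either keeping r, with weight [w], or raising it, with weight [c].  The
    raising weights met along a path are [c r, c r.+1, ...] whatever the order
    of the steps.  So are the others: their argument r + k is unchanged by a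
    raising step and drops by one at a keeping step.  All C(k, j) paths with j
    raising steps thus have the same weight.  The induction removes the first
    step of the path. *)
Lemma two_param_rec_sum (R : comNzRingType) (w c : nat -> R)
    (F : nat -> nat -> R) :
    (forall r, F 0%N r = 1) ->
    (forall k r, F k.+1 r = w (r + k.+1)%N * F k r + c r * F k r.+1) ->
  forall k r, F k r = \sum_(j < k.+1)
    'C(k, j)%:R * (\prod_(i < j) c (r + i)%N)
      * \prod_((r + j).+1 <= s < (r + k).+1) w s.
Proof.
move=> F0 FS; elim=> [|k IHk] r.
  by rewrite F0 big_ord1 bin0 big_ord0 addn0 big_geq // !mulr1.
rewrite FS !IHk [in RHS]big_ord_recl /= !mulr_sumr.
(* Pascal's rule sorts the paths by their first step. *)
under [X in _ = _ + X]eq_bigr => j _.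
  rewrite /bump /= add1n binS natrD !mulrDl; over.
rewrite big_split /= addrA; congr (_ + _).
- rewrite [in RHS]big_ord_recr /= (@bin_small k k.+1) // !mul0r addr0.
  rewrite big_ord_recl; congr (_ + _).
    rewrite !bin0 !big_ord0 !mul1r addn0 addnS [in RHS]big_nat_recr /=.
      by rewrite mulrC.
    by rewrite ltnS leq_addr.
  apply: eq_bigr => j _; rewrite lift0 addnS.
  rewrite [X in _ = _ * X]big_nat_recr /=; last by have := ltn_ord j; lia.
  by rewrite mulrC -!mulrA.
- apply: eq_bigr => j _.
  rewrite big_ord_recl addn0 /= -!mulrA mulrCA addSnnS; congr (_ * (_ * _)).
  rewrite !addnS !addSn; congr (_ * _); apply: eq_bigr => i _.
  by rewrite /bump addSn addnS.
Qed.

(** * Lucas polynomials *)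

(** The coefficient m/(m-j) * C(m-j, j) of t^j in the m-th Lucas polynomial, in
    a division-free form which moreover exhibits that polynomial as a sum of two
    Fibonacci polynomials. *)
Definition lucas_coef (m j : nat) : nat :=
  ('C(m - j, j) + (if j is i.+1 then 'C(m - j - 1, i) else 0))%N.

Lemma lucas_coefE m j : (0 < m)%N -> (j.*2 <= m)%N ->
  ((m - j) * lucas_coef m j = m * 'C(m - j, j))%N.
Proof.
case: j => [|j] m0 le_jm; first by rewrite /lucas_coef subn0 !bin0 addn0.
rewrite /lucas_coef mulnDr subn1 mul_bin_diag -mulnDl subnK //; lia.
Qed.

Lemma ffactnD n i j : (n ^_ (i + j) = n ^_ i * (n - i) ^_ j)%N.
Proof.
elim: j => [|j IHj]; first by rewrite addn0 muln1.
by rewrite addnS !ffactnSr IHj subnDA mulnA.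
Qed.

Lemma lucas_coef_ffact m j : (0 < m)%N -> (j.*2 <= m)%N ->
  (j`! * (lucas_coef m j * m.-1 ^_ j) = m ^_ j.*2)%N.
Proof.
move=> m0 le_jm; have jm : (0 < m - j)%N by lia.
apply/eqP; rewrite -(eqn_pmul2l jm); apply/eqP.
have E1 := lucas_coefE m0 le_jm.
have E2 : (m * m.-1 ^_ j = m ^_ j * (m - j))%N by rewrite -ffactnS ffactnSr.
have -> : (m ^_ j.*2 = m ^_ j * ('C(m - j, j) * j`!))%N.
  by rewrite bin_ffact -addnn ffactnD.
transitivity ((m - j) * lucas_coef m j * m.-1 ^_ j * j`!)%N; first by ring.
rewrite E1; transitivity (m * m.-1 ^_ j * 'C(m - j, j) * j`!)%N; first by ring.
by rewrite E2; ring.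
Qed.

Lemma two_step_ind (P : nat -> Prop) :
  P 0%N -> P 1%N -> (forall m, P m -> P m.+1 -> P m.+2) -> forall m, P m.
Proof.
move=> P0 P1 PS m; suff: P m /\ P m.+1 by case.
by elim: m => [|m [? ?]]; split; auto.
Qed.

Section LucasSum.
Variables (R : comNzRingType) (t : R).

(** With x + y = 1 and x * y = - t, [lucas m] is x^m + y^m and [fibonacci m]
    is (x^m.+1 - y^m.+1) / (x - y); the recurrences avoid adjoining x and y. *)
Fixpoint lucas (m : nat) : R :=
  match m with
  | 0 => 2%:R
  | 1 => 1
  | (m'.+1 as m1).+1 => lucas m1 + t * lucas m'
  end.

Fixpoint fibonacci (m : nat) : R :=
  match m with
  | 0 | 1 => 1
  | (m'.+1 as m1).+1 => fibonacci m1 + t * fibonacci m'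
  end.

(** The terms with m < 2 j vanish, so every N > m/2 gives the same sum; this
    freedom lets sums of different indices m be compared term by term. *)
Lemma fibonacci_sum m N : (m./2 < N)%N ->
  \sum_(j < N) 'C(m - j, j)%:R * t ^+ j = fibonacci m.
Proof.
have base m' N' : (m' < 2)%N -> (0 < N')%N ->
    \sum_(j < N') 'C(m' - j, j)%:R * t ^+ j = 1.
  case: N' => // N' m2 _; rewrite big_ord_recl bin0 mulr1 big1 ?addr0 // => j _.
  by rewrite bin_small ?mul0r //= /bump /=; lia.
elim/two_step_ind: m N => [||m IH0 IH1] [|N] // ltN; try exact: base.
have -> : fibonacci m.+2 = fibonacci m.+1 + t * fibonacci m by [].
have ltN0 : (m./2 < N)%N by [].
have ltN1 : (m.+1./2 < N.+1)%N by lia.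
rewrite -(IH1 N.+1 ltN1) -(IH0 N ltN0).
rewrite big_ord_recl [X in _ = X + _]big_ord_recl !bin0 -addrA mulr_sumr.
rewrite -big_split; congr (_ + _); apply: eq_bigr => j _ /=.
rewrite /bump add1n.
(* When m < j the truncated differences are 0, and j > 0 makes both sides 0. *)
have -> : 'C(m.+2 - j.+1, j.+1) = ('C(m.+1 - j.+1, j.+1) + 'C(m - j, j))%N.
  rewrite !subSS; have [le_jm|lt_mj] := leqP j m; first by rewrite subSn // binS.
  by rewrite !bin_small //; lia.
by rewrite natrD exprS; ring.
Qed.

Lemma lucas_fibonacci m : lucas m.+2 = fibonacci m.+2 + t * fibonacci m.
Proof.
elim/two_step_ind: m => [||m IH0 IH1]; try by rewrite /=; ring.
have -> : lucas m.+4 = lucas m.+3 + t * lucas m.+2 by [].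
by rewrite IH0 IH1 /=; ring.
Qed.

(** The value m = 0 is a genuine exception: [lucas 0] is 2, while the sum is 1. *)
Lemma lucas_sum m : (1 < m)%N ->
  \sum_(j < m./2.+1) (lucas_coef m j)%:R * t ^+ j = lucas m.
Proof.
case: m => [|[|m]] // _.
rewrite lucas_fibonacci -(@fibonacci_sum m.+2 m.+2./2.+1) //.
rewrite -(@fibonacci_sum m m./2.+1) //=.
under eq_bigr => j _ do rewrite natrD mulrDl.
rewrite big_split /=; congr (_ + _); rewrite big_ord_recl mul0r add0r mulr_sumr.
apply: eq_bigr => j _; rewrite lift0 subSS exprS mulrCA.
by have -> : (m.+1 - j - 1 = m - j)%N by lia.
Qed.

End LucasSum.

(** * Closed forms for the two ratios *)

(** Among the 2 j factors m, m-1, ..., m-2j+1, every other one is even, and the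
    even ones are the doubles of m/2, m/2-1, ...  The odd ones are m - 2i or
    m - 2i - 1 according to the parity of m: these are the two families of
    factors that occur in the recurrences. *)
Lemma ffact_double m j :
  (m ^_ j.*2 = 2 ^ j * m./2 ^_ j * \prod_(i < j) (m - i.*2 - ~~ odd m))%N.
Proof.
elim: j => [|j IHj]; first by rewrite big_ord0.
rewrite doubleS !ffactnSr IHj big_ord_recr expnS /=.
have -> : ((m - j.*2.+1) = m - j.*2 - 1)%N by lia.
set P := (\prod_(i < j) _)%N.
transitivity (2 ^ j * m./2 ^_ j * P * ((m - j.*2) * (m - j.*2 - 1)))%N.
  by ring.
have -> : ((m - j.*2) * (m - j.*2 - 1) =
           2 * (m./2 - j) * (m - j.*2 - ~~ odd m))%N.
  case: (boolP (odd m)) => /= modd.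
    have -> : (2 * (m./2 - j) = m - j.*2 - 1)%N by lia.
    by rewrite subn0 mulnC.
  by have -> : (2 * (m./2 - j) = m - j.*2)%N by lia.
by ring.
Qed.

(** Both sides become m^_(2j) once multiplied by j!. *)
Lemma bin_half_lucas_coef m j : (0 < m)%N -> (j.*2 <= m)%N ->
  (2 ^ j * 'C(m./2, j) * \prod_(i < j) (m - i.*2 - ~~ odd m)
     = lucas_coef m j * m.-1 ^_ j)%N.
Proof.
move=> m0 le_jm; apply/eqP; rewrite -(eqn_pmul2l (fact_gt0 j)); apply/eqP.
rewrite lucas_coef_ffact // ffact_double -(bin_ffact m./2); ring.
Qed.

Lemma halfprod_split m j : (j <= m./2)%N -> (0 < m)%N ->
  halfprod m = (m.-1 ^_ j)%:Z * \prod_(j.+1 <= s < (m./2).+1) (m%:Z - s%:Z).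
Proof.
move=> le_jm m0; rewrite /halfprod (@big_cat_nat _ _ _ j.+1) //=; congr (_ * _).
elim: j le_jm => [|j IHj] lt_jm; first by rewrite big_geq.
rewrite big_nat_recr //= IHj ?(ltnW lt_jm) // ffactnSr PoszM; congr (_ * _).
by lia.
Qed.

Lemma halfprod_neq0 m : (0 < m)%N -> halfprod m != 0.
Proof.
move=> m0; rewrite (@halfprod_split m m./2) // big_geq // mulr1.
by rewrite -lt0n ffact_gt0; lia.
Qed.

(** The previous identity in the shape of the path sums: [a] is the constant
    factor carried by each raising step, namely 4 for A and -2 for B. *)
Lemma bin_half_prod m j (a : int) : (0 < m)%N -> (j.*2 <= m)%N ->
  2 ^+ j * 'C(m./2, j)%:R
     * \prod_(i < j) (a * (m%:Z - 2%:Z * i%:Z - (~~ odd m)%:Z))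
  = a ^+ j * (lucas_coef m j * m.-1 ^_ j)%N%:Z.
Proof.
move=> m0 le_jm; rewrite -bin_half_lucas_coef // !PoszM.
have -> : \prod_(i < j) (a * (m%:Z - 2%:Z * i%:Z - (~~ odd m)%:Z)) =
    a ^+ j * (\prod_(i < j) (m - i.*2 - ~~ odd m))%N%:Z.
  elim: j le_jm => [|j IHj] le_jm; first by rewrite !big_ord0.
  rewrite !big_ord_recr /= IHj; last by lia.
  have -> : m%:Z - 2%:Z * j%:Z - (~~ odd m)%:Z = (m - j.*2 - ~~ odd m)%N%:Z.
    by lia.
  by rewrite PoszM exprS; ring.
by rewrite -!natz natrX; ring.
Qed.

(** The weights contribute 2^j times the j-th Lucas coefficient, whence the
    parameter t = 2; the roots of X^2 - X - 2 are 2 and -1. *)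
Lemma Arec_odd p : odd p -> (1 < p)%N ->
  Arec p p./2 0 = (2 ^+ p - 1) * halfprod p.
Proof.
move=> p_odd p1.
have lucas2 : lucas (2 : int) p = 2 ^+ p + (-1) ^+ p.
  elim/two_step_ind: p {p_odd p1} => [||p IH0 IH1] //.
  have -> : lucas (2 : int) p.+2 = lucas (2 : int) p.+1 + 2 * lucas 2 p by [].
  by rewrite IH0 IH1 !exprS; ring.
rewrite -signr_odd p_odd in lucas2.
rewrite -lucas2 -lucas_sum // mulr_suml.
rewrite (@two_param_rec_sum _ (fun s => p%:Z - s%:Z)
   (fun r => 4%:Z * (p%:Z - 2%:Z * r%:Z)) (Arec p)) //; last first.
  by move=> k r; rewrite /= PoszD; ring.
apply: eq_bigr => j _; have le_j : (j <= p./2)%N := ltn_ord j.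
rewrite (halfprod_split le_j) ?add0n ?(ltnW p1) // !mulrA; congr (_ * _).
have le_jp : (j.*2 <= p)%N by lia.
apply: (@mulfI _ (2 ^+ j)); first exact: expf_neq0.
under eq_bigr => i _ do rewrite add0n -[_ - _]subr0.
have := bin_half_prod 4%:Z (ltnW p1) le_jp; rewrite p_odd PoszM => bin.
rewrite mulrA bin natz (_ : 4%:Z = 2 * 2) // exprMn.
by ring.
Qed.

(** The trace (2 + sqrt 3)^k + (2 - sqrt 3)^k. *)
Fixpoint tr_pow (k : nat) : int :=
  match k with
  | 0 => 2
  | 1 => 4
  | (k'.+1 as k1).+1 => 4 * tr_pow k1 - tr_pow k'
  end.

(** For t = 1/2 the roots (1 + sqrt 3)/2 and (1 - sqrt 3)/2 of X^2 - X - t have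
    squares (2 + sqrt 3)/2 and (2 - sqrt 3)/2. *)
Lemma lucas_half K : 2 ^+ K * lucas (2^-1 : rat) K.*2 = (tr_pow K)%:~R.
Proof.
elim/two_step_ind: K => [||K IH0 IH1].
- by rewrite mul1r.
- by apply/eqP; rewrite /=.
have rec m : lucas (2^-1 : rat) m.+2 = lucas 2^-1 m.+1 + 2^-1 * lucas 2^-1 m.
  by [].
have -> : tr_pow K.+2 = 4 * tr_pow K.+1 - tr_pow K by [].
rewrite intrB intrM -IH0 -IH1 !doubleS !rec !exprS (_ : 4%:~R = 4 :> rat) //.
by field.
Qed.

(** The constant -2 occurs in both kinds of weight, but a raising step also
    brings a factor 1/2: the total is (-2)^(n/2) times the Lucas polynomial at
    t = 1/2, in which powers of 2 absorb all denominators. *)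
Lemma Brec_even n : ~~ odd n -> (1 < n)%N ->
  Brec n n./2 0 = (-1) ^+ n./2 * tr_pow n./2 * halfprod n.
Proof.
move=> n_even n1.
have trE : tr_pow n./2 =
    \sum_(j < n./2.+1) 2 ^+ (n./2 - j) * (lucas_coef n j)%:Z.
  apply: (@intr_inj rat); rewrite -lucas_half even_halfK // -lucas_sum //.
  rewrite rmorph_sum mulr_sumr; apply: eq_bigr => j _ /=.
  have le_j : (j <= n./2)%N := ltn_ord j.
  have -> : 2 ^+ n./2 = 2 ^+ (n./2 - j) * 2 ^+ j :> rat.
    by rewrite -exprD subnK.
  rewrite intrM rmorphXn /= -pmulrn exprVn (_ : 2%:~R = 2 :> rat) //.
  by field; apply: expf_neq0.
rewrite trE mulr_sumr mulr_suml.
rewrite (@two_param_rec_sum _ (fun s => (-2) * (n%:Z - s%:Z))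
   (fun r => (-2) * (n%:Z - 2%:Z * r%:Z - 1)) (Brec n)) //; last first.
  by move=> k r; rewrite /= PoszD; ring.
apply: eq_bigr => j _; have le_j : (j <= n./2)%N := ltn_ord j.
rewrite (halfprod_split le_j) ?add0n ?(ltnW n1) //.
have -> : \prod_(j.+1 <= s < n./2.+1) (-2 * (n%:Z - s%:Z)) =
    (-2) ^+ (n./2 - j) * \prod_(j.+1 <= s < n./2.+1) (n%:Z - s%:Z).
  by rewrite big_split /= prodr_const_nat subSS.
rewrite !mulrA; congr (_ * _).
have le_jn : (j.*2 <= n)%N by lia.
apply: (@mulfI _ (2 ^+ j)); first exact: expf_neq0.
under eq_bigr => i _ do rewrite add0n.
have := bin_half_prod (-2) (ltnW n1) le_jn; rewrite n_even PoszM => bin.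
have E : 2 ^+ n./2 = 2 ^+ j * 2 ^+ (n./2 - j) :> int.
  by rewrite -exprD subnKC.
rewrite !mulrA bin mulrAC -exprD (subnKC le_j) [(-2) ^+ _]exprNn E.
by ring.
Qed.

(** * The Lucas-Lehmer test *)

Lemma order_two_power (L : fieldType) (x : L) m d :
  x ^+ (2 ^ m) = -1 -> 2%:R != 0 :> L -> x ^+ d = 1 -> (2 ^ m.+1 %| d)%N.
Proof.
move=> xm two_neq0 xd.
have xS : x ^+ (2 ^ m.+1) = 1 by rewrite expnSr exprM xm sqrrN expr1n.
have [e e_prim] := prim_order_exists (expn_gt0 2 m.+1) xS.
case/(dvdn_pfactor _ _ (isT : prime 2)) => k le_k eE.
move: le_k; rewrite leq_eqVlt ltnS => /orP[/eqP <-|le_km].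
  by rewrite -eE (prim_order_dvd e_prim) xd.
have: x ^+ (2 ^ m) == 1.
  by rewrite -(prim_order_dvd e_prim) eE dvdn_exp2l.
by rewrite xm eq_sym -addr_eq0 (negPf two_neq0).
Qed.

Lemma two_neq0_char (L : fieldType) q :
  q \in [pchar L] -> (2 < q)%N -> 2%:R != 0 :> L.
Proof.
move=> q_char q2; rewrite -(dvdn_pcharf q_char).
by apply/negP => /dvdn_leq; lia.
Qed.

(** Here z stands for 2 + sqrt 3, and its conjugate is 4 - z = 1/z. *)
Section RootsOfTracePolynomial.
Variables (L : fieldType) (z : L).
Hypothesis zE : z ^+ 2 = 4%:R * z - 1.

Lemma trace_root_neq0 : z != 0.
Proof.
apply/eqP => z0; move/eqP: zE; rewrite z0 expr0n mulr0 sub0r eq_sym.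
by rewrite oppr_eq0 oner_eq0.
Qed.

Lemma tr_powM k : (tr_pow k)%:~R * z ^+ k = z ^+ k.*2 + 1.
Proof.
elim/two_step_ind: k => [||k IH0 IH1].
- by rewrite !expr0 mulr1.
- by rewrite !expr1 /= (_ : 4%:~R = 4%:R :> L) // zE subrK.
have -> : tr_pow k.+2 = 4 * tr_pow k.+1 - tr_pow k by [].
have -> : ((4 * tr_pow k.+1 - tr_pow k)%:~R : L) * z ^+ k.+2
    = 4%:R * z * ((tr_pow k.+1)%:~R * z ^+ k.+1)
      - z ^+ 2 * ((tr_pow k)%:~R * z ^+ k).
  by rewrite intrB intrM (_ : 4%:~R = 4%:R :> L) // !exprS; ring.
rewrite IH0 IH1 !doubleS.
have -> : 4%:R * z = z ^+ 2 + 1 by rewrite zE subrK.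
by rewrite !exprS; ring.
Qed.

Lemma tr_pow_eq0 k : (tr_pow k)%:~R = 0 :> L <-> z ^+ k.*2 = -1.
Proof.
split=> [tr0|z2k].
  by apply/eqP; rewrite -addr_eq0 -tr_powM tr0 mul0r.
have /eqP := tr_powM k; rewrite z2k addNr mulf_eq0 expf_eq0.
by rewrite (negbTE trace_root_neq0) andbF orbF => /eqP.
Qed.

Variable q : nat.
Hypothesis q_char : q \in [pchar L].

(** Frobenius sends z to a root of the same polynomial, hence to z or 1/z. *)
Lemma trace_root_Frobenius : z ^+ q = z \/ z ^+ q.+1 = 1.
Proof.
have: (z ^+ q) ^+ 2 = 4%:R * z ^+ q - 1.
  rewrite -!(pFrobenius_autE q_char) -rmorphXn zE.
  by rewrite rmorphB rmorphM rmorph_nat rmorph1.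
move=> zqE; have /eqP: (z ^+ q - z) * (z ^+ q - (4%:R - z)) = 0.
  transitivity (((z ^+ q) ^+ 2 - 4%:R * z ^+ q) - (z ^+ 2 - 4%:R * z)).
    by ring.
  by rewrite zqE zE; ring.
rewrite mulf_eq0 !subr_eq0 => /orP[/eqP|/eqP zq]; [by left|right].
by rewrite exprSr zq mulrBl -expr2 zE; ring.
Qed.

(** The order of z is exactly 2^(m+1), and it divides q - 1 or q + 1. *)
Lemma lucas_lehmer_lower_bound m : (2 < q)%N ->
  z ^+ (2 ^ m) = -1 -> (2 ^ m.+1 <= q.+1)%N.
Proof.
move=> q2 zm; have order := order_two_power zm (two_neq0_char q_char q2).
have [zq|/order /dvdn_leq->//] := trace_root_Frobenius.
suff /order /dvdn_leq le_q : z ^+ q.-1 = 1.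
  by apply: leq_trans (le_q _) _; lia.
apply: (mulfI trace_root_neq0).
by rewrite mulr1 -exprS prednK // ltnW // ltnW.
Qed.

End RootsOfTracePolynomial.

Lemma exists_quadratic_root (L : closedFieldType) (b c : L) :
  exists x, x ^+ 2 = b * x + c.
Proof.
have [x xE] := solve_monicpoly (nth 0 [:: c; b]) (isT : 0 < 2)%N.
by exists x; rewrite xE !big_ord_recl big_ord0 /= expr0 expr1; ring.
Qed.

Lemma exists_closed_field_char q : prime q ->
  exists L : closedFieldType, q \in [pchar L].
Proof.
move=> q_prime; have [L [FtoL _]] := countable_algebraic_closure 'F_q.
exists L; exact: rmorph_pchar FtoL _ (pchar_Fp q_prime).
Qed.

(** Put s = z - 1, which is 1 + sqrt 3, so that s^2 = 2 z.  As 3 is not a square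
    modulo q, Frobenius changes the sign of sqrt 3 and s^(q+1) is the norm
    (1 + sqrt 3)(1 - sqrt 3) = -2.  On the other hand
    s^(q+1) = (2 z)^((q+1)/2) = 2 z^((q+1)/2), since 2 is a square modulo q.
    No reciprocity law is involved: -3 is a square because q = 1 mod 3, and -1 is
    not because q = 3 mod 4. *)
Lemma lucas_lehmer_Mersenne (L : closedFieldType) (z : L) m :
  z ^+ 2 = 4%:R * z - 1 -> (0 < m)%N -> ~~ odd m ->
  (2 ^ m.+1 - 1)%N \in [pchar L] -> z ^+ (2 ^ m) = -1.
Proof.
set q := (2 ^ m.+1 - 1)%N => zE m0 m_even q_char.
have Frob (x y : L) : (x + y) ^+ q = x ^+ q + y ^+ q.
  by rewrite -!(pFrobenius_autE q_char) rmorphD.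
have Frob_nat n : (n%:R : L) ^+ q = n%:R.
  by rewrite -(pFrobenius_autE q_char) rmorph_nat.
have q_odd : q = (2 ^ m - 1).*2.+1.
  by have := expn_gt0 2 m; rewrite /q expnS; lia.
have q6 : (6 < q)%N.
  by have := @leq_pexp2l 2 2 m isT ltac:(lia); lia.
have two_neq0 : 2%:R != 0 :> L by apply: (two_neq0_char q_char); lia.
(* Euler's criterion: x ^+ q = x says that x lies in the prime field. *)
have Euler (x a : L) :
    x ^+ 2 = a -> x != 0 -> x ^+ q = x -> a ^+ (2 ^ m - 1) = 1.
  move=> <- x0 xq; apply: (mulfI x0).
  by rewrite mulr1 -exprM -exprS mul2n -q_odd.
have m_mod3 : exists t, (2 ^ m = 3 * t + 1)%N.
  rewrite -(even_halfK m_even); elim: (m./2) => [|h [t tE]]; first by exists 0%N.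
  by exists (4 * t + 1)%N; rewrite doubleS !expnS tE; lia.
have minus3 : (- 3%:R : L) ^+ (2 ^ m - 1) = 1.
  (* A primitive cube root of unity w lies in the prime field, q being 1 modulo
     3, and 2 w + 1 is a square root of -3. *)
  have [w wE] := exists_quadratic_root (-1 : L) (-1).
  have w3 : w ^+ 3 = 1.
    have -> : w ^+ 3 = w * w ^+ 2 by ring.
    by rewrite wE mulrDr mulrCA -expr2 wE; ring.
  have wq : w ^+ q = w.
    have [k kE] : exists k, q = (3 * k).+1.
      by have [t tE] := m_mod3; exists (2 * t)%N; rewrite /q expnS tE; lia.
    by rewrite kE exprS exprM w3 expr1n mulr1.
  pose v := 2%:R * w + 1.
  have v2 : v ^+ 2 = - 3%:R.
    have -> : v ^+ 2 = 4%:R * w ^+ 2 + 4%:R * w + 1 by rewrite /v; ring.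
    by rewrite wE; ring.
  have v0 : v != 0.
    rewrite -sqrf_eq0 v2 oppr_eq0 -(dvdn_pcharf q_char).
    by apply/negP => /dvdn_leq; lia.
  apply: Euler v2 v0 _.
  by rewrite Frob exprMn Frob_nat wq expr1n.
have three : (3%:R : L) ^+ (2 ^ m - 1) = -1.
  have odd_exp : odd (2 ^ m - 1) by rewrite oddB ?expn_gt0 // oddX /=; lia.
  move: minus3; rewrite exprNn -signr_odd odd_exp expr1 mulN1r => /eqP.
  by rewrite eqr_oppLR => /eqP.
have two : (2%:R : L) ^+ (2 ^ m - 1) = 1.
  (* 2^(m+2) = 2 q + 2 is 2 in L, and m is even. *)
  pose g := (2%:R : L) ^+ (m./2).+1.
  have g2 : g ^+ 2 = 2%:R.
    rewrite /g -exprM muln2 doubleS even_halfK // -natrX.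
    have -> : (2 ^ m.+2 = 2 * q + 2)%N by rewrite /q !expnS; lia.
    by rewrite natrD natrM (pcharf0 q_char) mulr0 add0r.
  apply: Euler g2 (expf_neq0 _ two_neq0) _.
  by rewrite /g -natrX Frob_nat.
pose s := z - 1.
have s2 : s ^+ 2 = 2%:R * z.
  have -> : s ^+ 2 = z ^+ 2 - 2%:R * z + 1 by rewrite /s; ring.
  by rewrite zE; ring.
have rq : (z - 2%:R) ^+ q = 2%:R - z.
  have r2 : (z - 2%:R) ^+ 2 = 3%:R.
    have -> : (z - 2%:R) ^+ 2 = z ^+ 2 - 4%:R * z + 4%:R by ring.
    by rewrite zE; ring.
  by rewrite q_odd exprS -mul2n exprM r2 three; ring.
have sq : s ^+ q = 3%:R - z.
  have -> : s = (z - 2%:R) + 1 by rewrite /s; ring.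
  by rewrite Frob rq expr1n; ring.
(* The norm of s. *)
have sSq : s ^+ q.+1 = - 2%:R.
  rewrite exprS sq.
  have -> : s * (3%:R - z) = 4%:R * z - 3%:R - z ^+ 2 by rewrite /s; ring.
  by rewrite zE; ring.
apply: (mulfI two_neq0).
rewrite mulrN1 -sSq.
have -> : q.+1 = (2 * 2 ^ m)%N by rewrite q_odd; lia.
rewrite exprM s2 exprMn; congr (_ * _).
have -> : (2 ^ m = (2 ^ m - 1).+1)%N by lia.
by rewrite exprS two mulr1.
Qed.

(** Any prime factor q of M = 2^p - 1 serves in the direction from divisibility
    to primality: the lower bound q >= M leaves only q = M. *)
Lemma lucas_lehmer p : odd p -> (2 < p)%N ->
  prime (2 ^ p - 1) <-> ((2 ^ p - 1)%N%:Z %| tr_pow (2 ^ p.-2))%Z.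
Proof.
move=> p_odd p2; set M := (2 ^ p - 1)%N.
have pE : (p = p.-2.+2)%N by lia.
have double_exp : ((2 ^ p.-2).*2 = 2 ^ p.-1)%N by rewrite pE -mul2n expnS.
have M6 : (6 < M)%N by have := @leq_pexp2l 2 3 p isT p2; rewrite /M; lia.
split=> [M_prime|M_dvd].
  have [L L_char] := exists_closed_field_char M_prime.
  have [z zE] := exists_quadratic_root (4%:R : L) (-1).
  rewrite (dvdz_pcharf L_char); apply/eqP/(tr_pow_eq0 zE).
  rewrite double_exp; apply: lucas_lehmer_Mersenne zE _ _ _; try by lia.
  by rewrite prednK //; lia.
set q := pdiv M; have q_prime : prime q by apply: pdiv_prime; lia.
have q_dvd : (q %| M)%N := pdiv_dvd M.
have [L L_char] := exists_closed_field_char q_prime.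
have [z zE] := exists_quadratic_root (4%:R : L) (-1).
have trq : (tr_pow (2 ^ p.-2))%:~R = 0 :> L.
  by apply/eqP; rewrite -(dvdz_pcharf L_char); apply: dvdz_trans M_dvd.
have q2 : (2 < q)%N.
  rewrite ltn_neqAle prime_gt1 // andbT; apply/eqP => qE.
  by move: q_dvd; rewrite -qE dvdn2 /M oddB ?expn_gt0 // oddX; lia.
move/(tr_pow_eq0 zE): trq; rewrite double_exp.
move/(lucas_lehmer_lower_bound zE L_char q2); rewrite prednK; last by lia.
move=> le_q; suff <- : q = M by [].
by have := dvdn_leq (ltn_trans (isT : 0 < 6)%N M6) q_dvd; lia.
Qed.

Theorem theorem1 (p : nat) (hp : prime p) (hp5 : (5 <= p)%N) :
  exists a b : int,
    [/\ Aratio p = a%:~R,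
        Bratio (2 ^ p.-1)%N = b%:~R
      & prime (2 ^ p - 1)%N <-> (a %| b)%Z].
Proof.
have p_odd : odd p.
  by case: (even_prime hp) => // p2; rewrite p2 in hp5.
set n := (2 ^ p.-1)%N.
have pE : p.-1 = p.-2.+1 by lia.
have half_n : n./2 = (2 ^ p.-2)%N by rewrite /n pE expnS mul2n doubleK.
have n_even : ~~ odd n by rewrite /n pE oddX.
have half_even : ~~ odd n./2 by rewrite half_n oddX /=; lia.
have n1 : (1 < n)%N by rewrite /n pE expnS; have := expn_gt0 2 p.-2; lia.
exists (2 ^ p - 1)%N%:Z, (tr_pow (2 ^ p.-2)); split.
- rewrite /Aratio Arec_odd ?rmorphM ?mulfK ?intr_eq0 ?halfprod_neq0 //; try lia.
  by rewrite -subzn ?expn_gt0 // -natz natrX.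
- rewrite /Bratio Brec_even // -signr_odd (negPf half_even) mul1r half_n.
  by rewrite rmorphM mulfK // intr_eq0 halfprod_neq0 // ltnW.
by apply: lucas_lehmer => //; lia.
Qed.
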